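(* Every bounded Krull order is a BF-ring.
   Context: Rings are associative with identity. Let $R$ be a prime Goldie ring (left and right) with simple artinian classical quotient ring $Q$. $R$ is a maximal order if there is no ring $R'$ with $R\subsetneq R'\subseteq Q$ such that $aR'b\subseteq R$ for some units $a,b$ of $Q$. For a right ideal $F$ of $R$ and $r\in R$ put $r^{-1}F=\{x\in R: rx\in F\}$, and let $\mathcal F$ be the set of right ideals $F$ of $R$ such that for every $r\in R$ one has $\{q\in Q: q\,(r^{-1}F)\subseteq R\}=R$. A right ideal $I$ of $R$ is $\tau$-closed if $r\in R$ and $rF\subseteq I$ for some $F\in\mathcal F$ imply $r\in I$; $\tau$-closed left ideals are defined symmetrically. $R$ is a Krull order (in the sense of Chamarie) if it is a maximal order satisfying the ascending chain condition on $\tau$-closed right ideals and on $\tau$-closed left ideals. $R$ is bounded if every essential right ideal and every essential left ideal contains a nonzero two-sided ideal. For bounded prime Goldie rings this notion of Krull order agrees with that of Marubayashi. $R^\bullet$ is the multiplicative monoid of cancellative elements (neither left nor right zero-divisors) of $R$. A nonunit $u\in R^\bullet$ is an atom if $u=ab$ with $a,b\in R^\bullet$ implies that $a$ or $b$ is a unit. $R$ is a BF-ring if every nonunit of $R^\bullet$ is a finite product of atoms of $R^\bullet$ and for every $a\in R^\bullet$ there is $\lambda(a)\in\mathbb{Z}_{\ge 0}$ such that $k\le\lambda(a)$ whenever $a=u_1\cdots u_k$ with atoms $u_i$ of $R^\bullet$. *)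

(* Defs.v *)
From mathcomp Require Import all_boot all_order all_algebra.
From mathcomp Require Import classical_sets.
Set Implicit Arguments.
Unset Strict Implicit.
Unset Printing Implicit Defensive.
Import GRing.Theory.
Local Open Scope classical_set_scope.
Local Open Scope ring_scope.

Definition acc (T : Type) (P : set T -> Prop) : Prop :=
  forall I : nat -> set T,
    (forall n, P (I n)) -> (forall n, I n `<=` I n.+1) ->
    exists N, forall n, (N <= n)%N -> I n = I N.

Definition dcc (T : Type) (P : set T -> Prop) : Prop :=
  forall I : nat -> set T,
    (forall n, P (I n)) -> (forall n, I n.+1 `<=` I n) ->
    exists N, forall n, (N <= n)%N -> I n = I N.

(* Closure under opposites follows from closure under multiplication by -1.   *)
Definition right_ideal (R : nzRingType) (I : set R) : Prop :=
  [/\ I 0, forall x y, I x -> I y -> I (x + y)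
    & forall x r, I x -> I (x * r)].

Definition left_ideal (R : nzRingType) (I : set R) : Prop :=
  [/\ I 0, forall x y, I x -> I y -> I (x + y)
    & forall x r, I x -> I (r * x)].

Definition two_sided_ideal (R : nzRingType) (I : set R) : Prop :=
  right_ideal I /\ left_ideal I.

Definition nonzero_set (R : nzRingType) (I : set R) : Prop :=
  exists2 x, I x & x <> 0.

Definition is_subring (R : nzRingType) (S : set R) : Prop :=
  [/\ S 1, forall x y, S x -> S y -> S (x - y)
    & forall x y, S x -> S y -> S (x * y)].

Definition prime_ring (R : nzRingType) : Prop :=
  forall a b : R, (forall r, a * r * b = 0) -> a = 0 \/ b = 0.

Definition right_annihilator (R : nzRingType) (S : set R) : set R :=
  [set x | forall s, S s -> s * x = 0].

Definition left_annihilator (R : nzRingType) (S : set R) : set R :=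
  [set x | forall s, S s -> x * s = 0].

(* The sum of the additive subgroups I 0, I 1, ... is direct.                 *)
Definition independent (R : nzRingType) (I : nat -> set R) : Prop :=
  forall (n : nat) (x : nat -> R), (forall i, I i (x i)) ->
    \sum_(i < n) x i = 0 -> forall i, (i < n)%N -> x i = 0.

Definition right_goldie (R : nzRingType) : Prop :=
  acc (fun I : set R => exists S, I = right_annihilator S) /\
  ~ (exists I : nat -> set R,
       [/\ forall n, right_ideal (I n), forall n, nonzero_set (I n)
         & independent I]).

Definition left_goldie (R : nzRingType) : Prop :=
  acc (fun I : set R => exists S, I = left_annihilator S) /\
  ~ (exists I : nat -> set R,
       [/\ forall n, left_ideal (I n), forall n, nonzero_set (I n)
         & independent I]).

Definition goldie_ring (R : nzRingType) : Prop :=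
  right_goldie R /\ left_goldie R.

Definition simple_ring (R : nzRingType) : Prop :=
  forall I : set R, two_sided_ideal I -> I = [set 0] \/ I = setT.

Definition artinian_ring (R : nzRingType) : Prop :=
  dcc (@right_ideal R) /\ dcc (@left_ideal R).

Definition cancellative (R : nzRingType) (a : R) : Prop :=
  GRing.lreg a /\ GRing.rreg a.

(* The subring R of Q is represented by an injective ring morphism iota.      *)
Definition classical_quotient_ring (R Q : unitRingType)
    (iota : {rmorphism R -> Q}) : Prop :=
  [/\ injective iota,
      forall s, cancellative s -> iota s \is a GRing.unit,
      forall q, exists a s, cancellative s /\ q = iota a / iota s
    & forall q, exists a s, cancellative s /\ q = (iota s)^-1 * iota a].

Definition maximal_order (R Q : unitRingType)
    (iota : {rmorphism R -> Q}) : Prop :=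
  ~ exists R' : set Q,
      [/\ is_subring R', range iota `<` R'
        & exists a b, [/\ a \is a GRing.unit, b \is a GRing.unit
            & forall x, R' x -> range iota (a * x * b)]].

(* The family of the F in \mathcal F.  The set of the x such that F (r * x)   *)
(* is r^{-1}F.                                                                *)
Definition right_dense (R Q : unitRingType) (iota : {rmorphism R -> Q})
    (F : set R) : Prop :=
  right_ideal F /\
  forall r, [set q | forall x, F (r * x) -> range iota (q * iota x)]
            = range iota.

Definition left_dense (R Q : unitRingType) (iota : {rmorphism R -> Q})
    (F : set R) : Prop :=
  left_ideal F /\
  forall r, [set q | forall x, F (x * r) -> range iota (iota x * q)]
            = range iota.

Definition right_tau_closed (R Q : unitRingType) (iota : {rmorphism R -> Q})
    (I : set R) : Prop :=
  right_ideal I /\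
  forall r F, right_dense iota F -> (forall x, F x -> I (r * x)) -> I r.

Definition left_tau_closed (R Q : unitRingType) (iota : {rmorphism R -> Q})
    (I : set R) : Prop :=
  left_ideal I /\
  forall r F, left_dense iota F -> (forall x, F x -> I (x * r)) -> I r.

(* Krull order in the sense of Chamarie.                                      *)
Definition krull_order (R Q : unitRingType)
    (iota : {rmorphism R -> Q}) : Prop :=
  [/\ maximal_order iota, acc (right_tau_closed iota)
    & acc (left_tau_closed iota)].

Definition essential_right_ideal (R : nzRingType) (E : set R) : Prop :=
  right_ideal E /\
  forall J, right_ideal J -> nonzero_set J -> nonzero_set (E `&` J).

Definition essential_left_ideal (R : nzRingType) (E : set R) : Prop :=
  left_ideal E /\
  forall J, left_ideal J -> nonzero_set J -> nonzero_set (E `&` J).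

Definition bounded_ring (R : nzRingType) : Prop :=
  forall E : set R, essential_right_ideal E \/ essential_left_ideal E ->
    exists I, [/\ two_sided_ideal I, nonzero_set I & I `<=` E].

(* A unit of R and its inverse are cancellative, so the units of the monoid   *)
(* of cancellative elements are those of R.                                   *)
Definition atom (R : unitRingType) (u : R) : Prop :=
  [/\ cancellative u, u \isn't a GRing.unit
    & forall a b, cancellative a -> cancellative b -> u = a * b ->
        a \is a GRing.unit \/ b \is a GRing.unit].

Definition BF_ring (R : unitRingType) : Prop :=
  (forall a : R, cancellative a -> a \isn't a GRing.unit ->
     exists s : seq R,
       (forall u, u \in s -> atom u) /\ a = \prod_(u <- s) u) /\
  (forall a : R, cancellative a ->
     exists l : nat, forall s : seq R,
       (forall u, u \in s -> atom u) -> a = \prod_(u <- s) u ->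
       (size s <= l)%N).

(* Main.v *)
Require Import Defs.
From mathcomp Require Import all_boot all_order all_algebra.
From mathcomp Require Import boolp classical_sets.

(** Let [a] be cancellative. A factorization of [a] into [k] nonunits gives a
    strict chain of [k + 1] principal right ideals from [a R] up to [R], and
    principal right ideals generated by cancellative elements are
    tau-closed. So it suffices that the chains of tau-closed right ideals above
    [a R] have bounded length: a factorization of [a] into as many nonunits as
    possible then consists of atoms ([BF_ring_bounded]).

    The bound is a Jordan-Hoelder argument. The tau-closed right ideals form a
    modular lattice, with join the [closure] of the sum. If [M] covers [N] in
    this lattice, a strictly increasing function on the part above [M] extends
    to the part above [N] at the cost of one more value
    ([height_function_cover]). By the ascending chain condition such a bounded
    function exists above [a R] as soon as every proper tau-closed right ideal
    [N] above [a R] has a cover ([exists_cover]).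

    Boundedness is what produces covers. As [a R] is essential, it contains a
    nonzero two-sided ideal [I], which kills [R / N]. Among the annihilators of
    the cyclic submodules of [R / N], a maximal one is a prime ideal [P]
    ([associated_prime]); it is tau-closed, and nonzero because it contains
    [I]. The chain condition also makes [R / P] right nonsingular
    ([nonsingular_mod]). Together with maximality of the order this shows that
    every right ideal that is essential modulo [P] lies in the filter of dense
    right ideals ([essential_dense]): if [q J] lies in [R] with [J] essential
    modulo [P], then [q P] lies in [R], so [P q] lies in the left multiplier
    ring of [P], which is [R]; as [P q] kills [J] modulo [P], it lies in [P],
    and [q] is in the right multiplier ring of [P], again [R]. Let now
    [U / N] be a uniform submodule of [R / N] contained in the cyclic module
    with annihilator [P] ([exists_uniform]). A tau-closed right ideal that
    contains [N] and meets [U] outside [N] contains all of [U], so the closure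
    of [U] covers [N]. *)

Set Implicit Arguments.
Unset Strict Implicit.
Unset Printing Implicit Defensive.
Import GRing.Theory.
Local Open Scope classical_set_scope.
Local Open Scope ring_scope.

(** * Maximal elements from chain conditions *)

(** The members need only satisfy an arbitrary extra property [S]: the chain
    condition is always applied to tau-closed right ideals, for several [S]. *)
Lemma acc_maximal (T : Type) (C S : set T -> Prop) :
  acc C -> (exists A, C A /\ S A) ->
  exists A, [/\ C A, S A & forall B, C B -> S B -> A `<=` B -> B `<=` A].
Proof.
move=> accC [A0 CSA0]; apply: contrapT => noMax.
have step (A : {A | C A /\ S A}) :
    exists B : {B | C B /\ S B}, sval A `<=` sval B /\ ~ (sval B `<=` sval A).
  apply: contrapT => noB; apply: noMax; case: A noB => A [CA SA] /= noB.
  exists A; split=> // B CB SB AB; apply: contrapT => nBA.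
  by apply: noB; exists (exist _ B (conj CB SB)).
have [f fP] := choice step.
pose I n := sval (iter n f (exist _ A0 CSA0)).
have [||N stab] := accC I.
- by move=> n; case: (svalP (iter n f (exist _ A0 CSA0))).
- by move=> n; case: (fP (iter n f (exist _ A0 CSA0))).
have [_] := fP (iter N f (exist _ A0 CSA0)); apply.
by have := stab N.+1 (leqnSn N); rewrite /I /= => ->.
Qed.

(** * Right ideals *)

Section RightIdeals.
Variable R : nzRingType.
Implicit Types (I J : set R) (r : R).

Definition colon r I : set R := [set x | I (r * x)].

Definition principal r : set R := [set x | exists y, x = r * y].

Definition add_set I J : set R :=
  [set x | exists y z, [/\ I y, J z & x = y + z]].

Lemma right_ideal0 I : right_ideal I -> I 0. Proof. by case. Qed.

Lemma right_idealD I x y : right_ideal I -> I x -> I y -> I (x + y).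
Proof. by move=> [_ D _]; apply: D. Qed.

Lemma right_idealM I x r : right_ideal I -> I x -> I (x * r).
Proof. by move=> [_ _ M]; apply: M. Qed.

Lemma right_idealB I x y : right_ideal I -> I x -> I y -> I (x - y).
Proof.
move=> rI Ix Iy; apply: right_idealD => //.
by rewrite -mulrN1; apply: right_idealM.
Qed.

Lemma right_ideal_colon r I : right_ideal I -> right_ideal (colon r I).
Proof.
move=> [I0 ID IM]; split; rewrite /colon /= ?mulr0 // => x y.
  by rewrite mulrDr; apply: ID.
by rewrite mulrA; apply: IM.
Qed.

Lemma right_ideal_setI I J :
  right_ideal I -> right_ideal J -> right_ideal (I `&` J).
Proof.
move=> [I0 ID IM] [J0 JD JM]; split=> //.
  by move=> x y [Ix Jx] [Iy Jy]; split; [apply: ID|apply: JD].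
by move=> x r [Ix Jx]; split; [apply: IM|apply: JM].
Qed.

Lemma right_ideal_add I J :
  right_ideal I -> right_ideal J -> right_ideal (add_set I J).
Proof.
move=> [I0 ID IM] [J0 JD JM]; split.
- by exists 0, 0; rewrite addr0.
- move=> _ _ [x [y [Ix Jy ->]]] [x' [y' [Ix' Jy' ->]]].
  exists (x + x'), (y + y'); split; [exact: ID|exact: JD|].
  by rewrite addrACA.
- move=> _ r [x [y [Ix Jy ->]]]; exists (x * r), (y * r).
  by split; [exact: IM|exact: JM|rewrite mulrDl].
Qed.

Lemma subset_addl I J : right_ideal J -> I `<=` add_set I J.
Proof. by move=> [J0 _ _] x Ix; exists x, 0; rewrite addr0. Qed.

Lemma subset_addr I J : right_ideal I -> J `<=` add_set I J.
Proof. by move=> [I0 _ _] x Jx; exists 0, x; rewrite add0r. Qed.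

Lemma right_ideal_principal r : right_ideal (principal r).
Proof.
split; first by exists 0; rewrite mulr0.
  by move=> _ _ [x ->] [y ->]; exists (x + y); rewrite mulrDr.
by move=> _ s [x ->]; exists (x * s); rewrite mulrA.
Qed.

Lemma principal_id r : principal r r. Proof. by exists 1; rewrite mulr1. Qed.

Lemma cancellative1 : cancellative (1 : R).
Proof. by split; [exact: lreg1|exact: rreg1]. Qed.

Lemma cancellativeM (a b : R) :
  cancellative a -> cancellative b -> cancellative (a * b).
Proof. by move=> [la ra] [lb rb]; split; [exact: lregM|exact: rregM]. Qed.

End RightIdeals.

(** * Closure with respect to dense right ideals *)

Section Closure.
Variables (R Q : unitRingType) (iota : {rmorphism R -> Q}).
Implicit Types (F G I J K : set R) (q : Q).

Lemma right_denseP F :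
  right_dense iota F <-> right_ideal F /\
    forall r q, (forall x, F (r * x) -> range iota (q * iota x)) ->
      range iota q.
Proof.
split=> [[rF dF]|[rF dF]]; split=> // r.
  by move=> q qF; rewrite -(dF r).
apply/seteqP; split=> [q|_ [y _ <-] x _] /=; first exact: dF.
by rewrite -rmorphM; exists (y * x).
Qed.

Lemma right_denseT : right_dense iota setT.
Proof.
apply/right_denseP; split=> // _ q /(_ 1 Logic.I).
by rewrite rmorph1 mulr1.
Qed.

Lemma right_dense_colon r F :
  right_dense iota F -> right_dense iota (colon r F).
Proof.
move=> /right_denseP[rF dF]; apply/right_denseP; split.
  exact: right_ideal_colon.
by move=> s q qF; apply: (dF (r * s)) => x; rewrite -mulrA; apply: qF.
Qed.

(** The local axiom of a Gabriel filter. For [r x] in [F], the element [q x]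
    multiplies the dense right ideal [colon (r * x) G] into [R], hence lies
    in [R]; so [q] multiplies [colon r F] into [R]. *)
Lemma right_dense_trans F G :
  right_dense iota F -> right_ideal G ->
  (forall f, F f -> right_dense iota (colon f G)) -> right_dense iota G.
Proof.
move=> /right_denseP[rF dF] rG dG; apply/right_denseP; split=> // r q qG.
apply: (dF r) => x /dG /right_denseP[_ /(_ 1)]; apply=> y.
rewrite mul1r /colon /= -(mulrA r) => /qG.
by rewrite rmorphM mulrA.
Qed.

Lemma right_dense_sub F G :
  right_dense iota F -> right_ideal G -> F `<=` G -> right_dense iota G.
Proof.
move=> dF rG FG; apply: (right_dense_trans dF) => // f /FG Gf.
have -> : colon f G = setT; last exact: right_denseT.
by apply/seteqP; split=> // x _; apply: right_idealM.
Qed.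

Lemma right_dense_setI F G :
  right_dense iota F -> right_dense iota G -> right_dense iota (F `&` G).
Proof.
move=> dF dG; have [rF _] := dF; have [rG _] := dG.
have rFG := right_ideal_setI rF rG.
apply: (right_dense_trans dF) => // f Ff.
apply: (right_dense_sub (right_dense_colon f dG)).
  exact: right_ideal_colon.
by move=> x Gfx; split=> //; apply: right_idealM.
Qed.

Definition closure K : set R :=
  [set r | exists2 F, right_dense iota F & F `<=` colon r K].

Lemma subset_closure K : right_ideal K -> K `<=` closure K.
Proof.
move=> rK x Kx; exists setT; first exact: right_denseT.
by move=> y _; apply: right_idealM.
Qed.

Lemma closure_min K I : right_tau_closed iota I -> K `<=` I -> closure K `<=` I.
Proof.
by move=> [_ cI] KI r [F dF Fr]; apply: (cI r F dF) => x /Fr; apply: KI.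
Qed.

Lemma closure_mono K I : K `<=` I -> closure K `<=` closure I.
Proof. by move=> KI r [F dF Fr]; exists F => // x /Fr; apply: KI. Qed.

(** Idempotence of the closure is the local axiom [right_dense_trans]. *)
Lemma closed_closure K : right_ideal K -> right_tau_closed iota (closure K).
Proof.
move=> rK; split=> [|r F dF rF].
  split.
  - by apply: subset_closure => //; apply: right_ideal0.
  - move=> x y [F dF Fx] [G dG Gy]; exists (F `&` G).
      exact: right_dense_setI.
    move=> z [/Fx Kxz /Gy Kyz]; rewrite /colon /= mulrDl.
    exact: right_idealD.
  - move=> x s [F dF Fx]; exists (colon s F); first exact: right_dense_colon.
    by move=> z /Fx; rewrite /colon /= mulrA.
exists (colon r K) => //.
apply: (right_dense_trans dF) => [|f /rF[G dG Gf]].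
  exact: right_ideal_colon.
apply: (right_dense_sub dG) => [|x /Gf].
  by do 2!apply: right_ideal_colon.
by rewrite /colon /= mulrA.
Qed.

Lemma closed_colon r I :
  right_tau_closed iota I -> right_tau_closed iota (colon r I).
Proof.
move=> [rI cI]; split=> [|s F dF sF]; first exact: right_ideal_colon.
by apply: (cI _ F dF) => x /sF; rewrite /colon /= mulrA.
Qed.

Lemma closed_bigcap (X : Type) (I : X -> set R) :
  (forall i, right_tau_closed iota (I i)) ->
  right_tau_closed iota [set r | forall i, I i r].
Proof.
move=> cI; split=> [|r F dF rF i]; last first.
  by have [_] := cI i; apply; [exact: dF|move=> x /rF/(_ i)].
split.
- by move=> i; have [/right_ideal0] := cI i.
- by move=> x y Ix Iy i; have [rI _] := cI i; apply: right_idealD.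
- by move=> x s Ix i; have [rI _] := cI i; apply: right_idealM.
Qed.

Lemma closed_setI I J :
  right_tau_closed iota I -> right_tau_closed iota J ->
  right_tau_closed iota (I `&` J).
Proof.
move=> [rI cI] [rJ cJ]; split=> [|r F dF rF]; first exact: right_ideal_setI.
by split; [apply: (cI r F dF)|apply: (cJ r F dF)] => x /rF[].
Qed.

(** If [r F] lies in [a R], then [a^-1 r] multiplies the dense [F] into [R], so
    it belongs to [R]. *)
Lemma closed_principal a :
  injective iota -> iota a \is a GRing.unit ->
  right_tau_closed iota (principal a).
Proof.
move=> inj ua; split=> [|r F /right_denseP[_ dF] rF].
  exact: right_ideal_principal.
have [x|y _ yE] := dF 1 ((iota a)^-1 * iota r).
  rewrite mul1r => /rF[y yE].
  by exists y => //; rewrite -mulrA -rmorphM yE rmorphM mulKr.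
exists y; apply: inj; rewrite rmorphM yE mulVKr //.
Qed.

End Closure.

(** * Two-sided ideals of a maximal order *)

Section MaximalOrder.
Variables (R Q : unitRingType) (iota : {rmorphism R -> Q}).
Hypotheses (simpleQ : simple_ring Q) (quotQ : classical_quotient_ring iota).
Implicit Type (P J : set R).

(** Simplicity of [Q] replaces Goldie's theorem on regular elements: the [q]
    that cancellative denominators on both sides move into [P] form a two-sided
    ideal of [Q] that contains [P], so [1] is among them. *)
Lemma ideal_cancellative P :
  two_sided_ideal P -> nonzero_set P -> exists2 c, P c & cancellative c.
Proof.
move=> [rP [_ _ lP]] [p Pp p0]; have [inj inv rfrac lfrac] := quotQ.
pose T := [set q | exists s t x,
  [/\ cancellative s, cancellative t, P x & iota s * q * iota t = iota x]].
have rT : right_ideal T.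
  split.
  - exists 1, 1, 0; rewrite mulr0 mul0r rmorph0.
    by split; [exact: cancellative1|exact: cancellative1|exact: right_ideal0|].
  - move=> q1 q2 [s1 [t1 [x1 [cs1 ct1 Px1 e1]]]].
    move=> [s2 [t2 [x2 [cs2 ct2 Px2 e2]]]].
    (* Common denominators [u * s1 = b * s2] and [t2 * v = t1 * c]. *)
    have [b [u [cu us]]] := lfrac (iota s1 / iota s2).
    have [c [v [cv vt]]] := rfrac ((iota t1)^-1 * iota t2).
    have {}us : iota u * iota s1 = iota b * iota s2.
      by rewrite -[iota s1](divrK (inv _ cs2)) us -!mulrA mulVKr ?inv.
    have {}vt : iota t2 * iota v = iota t1 * iota c.
      by rewrite -[iota t2](mulVKr (inv _ ct1)) vt -!mulrA mulVr ?inv ?mulr1.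
    exists (u * s1), (t2 * v), (u * x1 * c + b * x2 * v).
    split; [exact: cancellativeM|exact: cancellativeM| |].
      by apply: right_idealD => //; apply: right_idealM => //; apply: lP.
    rewrite mulrDr mulrDl rmorphD !rmorphM /= -e1 -e2; congr (_ + _).
      by rewrite vt !mulrA.
    by rewrite us !mulrA.
  - move=> q r [s [t [x [cs ct Px e]]]].
    have [c [v [cv vt]]] := rfrac ((iota t)^-1 * r).
    have {}vt : r * iota v = iota t * iota c.
      by rewrite -[r](mulVKr (inv _ ct)) vt -!mulrA mulVr ?inv ?mulr1.
    exists s, v, (x * c); split=> //; first exact: right_idealM.
    by rewrite rmorphM -e -!mulrA vt.
have lT : left_ideal T.
  have [T0 TD _] := rT; split=> // q r [s [t [x [cs ct Px e]]]].
  have [b [u [cu us]]] := lfrac (r / iota s).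
  have {}us : iota u * r = iota b * iota s.
    by rewrite -[r](divrK (inv _ cs)) us -!mulrA mulVKr ?inv.
  exists u, t, (b * x); split=> //; first exact: lP.
  by rewrite rmorphM -e !mulrA us.
have Tp : T (iota p).
  exists 1, 1, p; rewrite rmorph1 mulr1 mul1r.
  by split=> //; exact: cancellative1.
have [T0|TT] := simpleQ (conj rT lT).
  by move: Tp; rewrite T0 /= -(rmorph0 iota) => /inj.
have : T 1 by rewrite TT.
move=> [s [t [x [cs ct Px]]]]; rewrite mulr1 -rmorphM => /inj st.
by exists x => //; rewrite -st; apply: cancellativeM.
Qed.

Hypothesis maxR : maximal_order iota.

(** The form in which maximality is used: a ring between [R] and [Q] that is
    equivalent to [R] via cancellative elements of [R] is [R]. *)
Let max_order_sub (S : set Q) (a b : R) :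
  cancellative a -> cancellative b -> is_subring S -> range iota `<=` S ->
  (forall x, S x -> range iota (iota a * x * iota b)) -> S `<=` range iota.
Proof.
move=> ca cb sS RS aSb q Sq; apply: contrapT => nq; apply: maxR.
have [_ inv _ _] := quotQ.
exists S; split=> //; first by split=> // /(_ q Sq).
by exists (iota a), (iota b); split; [exact: inv|exact: inv|].
Qed.

(** The left multiplier ring of [P] is an order equivalent to [R]: right
    multiplication by a cancellative element of [P] takes it into [R]. *)
Lemma left_multiplier P q :
  two_sided_ideal P -> nonzero_set P ->
  (forall p, P p -> exists2 p', P p' & q * iota p = iota p') -> range iota q.
Proof.
move=> tP nzP qP; have [c Pc cc] := ideal_cancellative tP nzP.
have [rP [_ _ lP]] := tP.
pose S := [set q | forall p, P p -> exists2 p', P p' & q * iota p = iota p'].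
apply: (@max_order_sub S 1 c (@cancellative1 _)) => //.
- split=> [p Pp|x y Sx Sy p Pp|x y Sx Sy p Pp].
  + by exists p => //; rewrite mul1r.
  + have [x' Px' xE] := Sx p Pp; have [y' Py' yE] := Sy p Pp.
    exists (x' - y'); first exact: right_idealB.
    by rewrite mulrBl xE yE rmorphB.
  + have [y' Py' yE] := Sy p Pp; have [x' Px' xE] := Sx y' Py'.
    by exists x' => //; rewrite -mulrA yE.
- move=> _ [r _ <-] p Pp; exists (r * p); first exact: lP.
  by rewrite rmorphM.
- move=> x /(_ c Pc)[p' _ e]; rewrite rmorph1 mul1r e.
  by exists p'.
Qed.

Lemma right_multiplier P q :
  two_sided_ideal P -> nonzero_set P ->
  (forall p, P p -> exists2 p', P p' & iota p * q = iota p') -> range iota q.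
Proof.
move=> tP nzP qP; have [c Pc cc] := ideal_cancellative tP nzP.
have [rP [_ _ lP]] := tP.
pose S := [set q | forall p, P p -> exists2 p', P p' & iota p * q = iota p'].
apply: (@max_order_sub S c 1 cc (@cancellative1 _)) => //.
- split=> [p Pp|x y Sx Sy p Pp|x y Sx Sy p Pp].
  + by exists p => //; rewrite mulr1.
  + have [x' Px' xE] := Sx p Pp; have [y' Py' yE] := Sy p Pp.
    exists (x' - y'); first exact: right_idealB.
    by rewrite mulrBr xE yE rmorphB.
  + have [x' Px' xE] := Sx p Pp; have [y' Py' yE] := Sy x' Px'.
    by exists y' => //; rewrite mulrA xE.
- move=> _ [r _ <-] p Pp; exists (p * r); first exact: right_idealM.
  by rewrite rmorphM.
- move=> x /(_ c Pc)[p' _ e]; rewrite rmorph1 mulr1 e.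
  by exists p'.
Qed.

End MaximalOrder.

(** * Right ideals that are essential modulo a prime *)

Definition prime_ideal (R : nzRingType) (P : set R) : Prop :=
  two_sided_ideal P /\
  forall x y, (forall r, P (x * r * y)) -> P x \/ P y.

(** For right ideals [J] containing [P], this says that [J / P] is essential in
    [R / P]; testing on elements avoids forming the quotient. *)
Definition essential_over (R : nzRingType) (P J : set R) : Prop :=
  forall x, ~ P x -> exists2 r, J (x * r) & ~ P (x * r).

Section PrimeQuotient.
Variables (R Q : unitRingType) (iota : {rmorphism R -> Q}).
Hypothesis accR : acc (right_tau_closed iota).
Variable P : set R.
Hypotheses (primeP : prime_ideal P) (closedP : right_tau_closed iota P).
Implicit Type J : set R.

Lemma essential_over_colon r J :
  P `<=` J -> essential_over P J -> essential_over P (colon r J).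
Proof.
have [[rP [_ _ lP]] _] := primeP.
move=> PJ eJ x nPx; have [Prx|nPrx] := pselect (P (r * x)).
  by exists 1; rewrite mulr1 //; apply: PJ.
have [s Js nPs] := eJ _ nPrx; exists s; rewrite /colon /= ?mulrA //.
by move=> Pxs; apply: nPs; rewrite -mulrA; apply: lP.
Qed.

(** The classical argument that a prime ring with ascending chain condition on
    right annihilators has zero singular ideal. If [y] is a singular element
    modulo [P] with the largest possible annihilator, then for each [r] the
    singular element [y r] kills a nonzero multiple [y s], so [y r y] has a
    larger annihilator than [y] and must vanish modulo [P]. *)
Lemma nonsingular_mod z : essential_over P (colon z P) -> P z.
Proof.
have [[rP [_ _ lP]] prP] := primeP.
move=> ez; apply: contrapT => nPz.
pose S A := exists y, [/\ A = colon y P, ~ P y & essential_over P (colon y P)].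
have [|_ [_ [y [-> nPy ey]] maxy]] := acc_maximal (S := S) accR.
  by exists (colon z P); split; [exact: closed_colon|exists z].
have Py r : P (y * r * y).
  apply: contrapT => nPyry.
  have sub : colon y P `<=` colon (y * r * y) P.
    by move=> x Px; rewrite /colon /= -(mulrA (y * r)); apply: lP.
  (* The annihilator of [y * r] is essential, so it meets [y R] nontrivially. *)
  have [s Ps nPs] : exists2 s, P (y * r * (y * s)) & ~ P (y * s).
    have [|s Ps nPs] := essential_over_colon r _ ey nPy.
      by move=> x; apply: lP.
    by exists s; rewrite // -mulrA.
  apply: nPs; apply: (maxy (colon (y * r * y) P)) => //.
  - exact: closed_colon.
  - exists (y * r * y); split=> // x /ey[t /sub]; exists t => //.
  - by rewrite /colon /= -(mulrA (y * r)).
by have [] := prP _ _ Py.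
Qed.

Hypotheses (simpleQ : simple_ring Q) (quotQ : classical_quotient_ring iota).
Hypotheses (maxR : maximal_order iota) (nzP : nonzero_set P).

(** Each [colon r J] is again essential modulo [P] ([essential_over_colon]), so
    it is enough to see that only elements of [R] multiply such a [J] into [R].
    If [q] does, then [P q] lies in [R] because it consists of left
    multipliers of [P]; it kills [J] modulo [P], so it lies in [P] by
    nonsingularity, and [q] is a right multiplier of [P]. *)
Lemma essential_dense J :
  right_ideal J -> P `<=` J -> essential_over P J -> right_dense iota J.
Proof.
have [tP _] := primeP; have [rP [_ _ lP]] := tP; have [inj _ _ _] := quotQ.
move=> rJ PJ eJ; apply/right_denseP; split=> // r q qJ.
have PJ' : P `<=` colon r J by move=> x Px; apply/PJ/lP.
have ann t : (forall x, J (r * x) -> P (t * x)) -> P t.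
  move=> tJ; apply: nonsingular_mod => x /(essential_over_colon r PJ eJ).
  by move=> [s /tJ Ptxs nPs]; exists s.
have Rq p : P p -> exists2 t, P t & iota p * q = iota t.
  move=> Pp; have [|t _ tE] :=
      left_multiplier simpleQ quotQ maxR (q := iota p * q) tP nzP.
    move=> p' /PJ' /qJ[x _ xE]; exists (p * x); first exact: right_idealM.
    by rewrite -mulrA -xE rmorphM.
  exists t => //; apply: ann => x /qJ[y _ yE].
  have -> : t * x = p * y by apply: inj; rewrite !rmorphM tE yE mulrA.
  exact: right_idealM.
exact: right_multiplier Rq.
Qed.

End PrimeQuotient.

(** * Covers in the lattice of tau-closed right ideals *)

Section Covers.
Variables (R Q : unitRingType) (iota : {rmorphism R -> Q}).
Hypothesis accR : acc (right_tau_closed iota).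
Variable N : set R.
Hypothesis closedN : right_tau_closed iota N.

(** The annihilator of the submodule of [R / N] generated by [m]. It is an
    intersection of right ideals [colon (m * s) N], hence tau-closed. *)
Definition cyclic_annihilator m : set R := [set r | forall s, N (m * s * r)].

Lemma closed_cyclic_annihilator m :
  right_tau_closed iota (cyclic_annihilator m).
Proof. by apply: closed_bigcap => s; apply: closed_colon. Qed.

(** If [x R y] kills the module generated by [m], but [x] does not, then [y]
    kills some nonzero cyclic submodule [m s x R]. By maximality its annihilator
    is that of [m]. *)
Lemma associated_prime :
  (exists x, ~ N x) ->
  exists2 m, ~ N m & prime_ideal (cyclic_annihilator m).
Proof.
have [rN _] := closedN.
move=> [x0 nNx0].
pose S A := exists2 m, ~ N m & A = cyclic_annihilator m.
have [|_ [_ [m nNm ->] maxm]] := acc_maximal (S := S) accR.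
  exists (cyclic_annihilator x0); split; last by exists x0.
  exact: closed_cyclic_annihilator.
exists m => //; split.
  have [rA _] := closed_cyclic_annihilator m; split=> //.
  have [A0 AD _] := rA; split=> //.
  by move=> x r mx s; rewrite mulrA -(mulrA m); apply: mx.
move=> x y Pxy; have [|/existsNP[s nNs]] := pselect (cyclic_annihilator m x).
  by left.
right; apply: (maxm (cyclic_annihilator (m * s * x))).
- exact: closed_cyclic_annihilator.
- by exists (m * s * x).
- by move=> r mr t; rewrite -(mulrA m) -(mulrA m); apply: mr.
- by move=> t; rewrite -!mulrA (mulrA m) (mulrA x); apply: Pxy.
Qed.

(** For [u] outside [N], this says that [(u R + N) / N] is a uniform module:
    each of its nonzero cyclic submodules is essential. *)
Definition uniform_over u : Prop :=
  forall v w, principal u v -> ~ N v -> principal u w -> ~ N w ->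
  exists2 s, add_set (principal v) N (w * s) & ~ N (w * s).

(** Take a tau-closed [K] above [N] maximal among those that meet some [u R]
    only inside [N], where [u] is a multiple of [m] outside [N]. If two nonzero
    cyclic submodules [v R] and [w R] of [u R] were independent over [N], then
    the closure of [K + v R] would still meet [w R] only inside [N],
    contradicting the maximality of [K]. *)
Lemma exists_uniform m :
  ~ N m -> exists u, [/\ principal m u, ~ N u & uniform_over u].
Proof.
have [rN cN] := closedN => nNm.
pose S K := N `<=` K /\ exists u,
  [/\ principal m u, ~ N u & principal u `&` K `<=` N].
have [|K [cK [NK [u [mu nNu uKN]]] maxK]] := acc_maximal (S := S) accR.
  exists N; split=> //; split=> //; exists m.
  by split=> [||x []//]; first exact: principal_id.
exists u; split=> // v w uv nNv uw nNw; apply: contrapT => nosum.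
have [rK _] := cK.
have rKv := right_ideal_add rK (right_ideal_principal v).
have KK' : K `<=` closure iota (add_set K (principal v)).
  move=> x Kx; apply: subset_closure => //.
  exact: (subset_addl (right_ideal_principal v)).
have uM x y : principal u x -> principal u (x * y).
  by move=> ux; apply: right_idealM; first exact: right_ideal_principal.
suff /maxK : S (closure iota (add_set K (principal v))).
  move=> /(_ (closed_closure iota rKv) KK' v) Kv; apply: nNv; apply: uKN.
  split=> //; apply: Kv; apply: subset_closure => //.
  by apply: (subset_addr rK); apply: principal_id.
split; first by move=> x /NK /KK'.
exists w; split=> //.
  have [y ->] := uw; have [z ->] := mu.
  by exists (z * y); rewrite mulrA.
move=> _ [[t ->] [F dF wtF]]; apply: (cN _ F dF) => f /wtF.
move=> [k [_ [Kk [y ->] e]]].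
apply: contrapT => nN; apply: nosum; exists (t * f); last by rewrite mulrA.
exists (v * y), k; split; first by exists y.
- apply: uKN; split=> //.
  have -> : k = w * t * f - v * y by rewrite e addrK.
  apply: right_idealB; first exact: right_ideal_principal.
    by rewrite -mulrA; apply: uM.
  exact: uM.
- by rewrite mulrA e addrC.
Qed.

Hypotheses (simpleQ : simple_ring Q) (quotQ : classical_quotient_ring iota).
Hypothesis maxR : maximal_order iota.

(** The cover is the closure of [u R + N], with [u] uniform over [N] and
    generating a module killed by a prime [P]. A tau-closed [W] that contains
    [N] strictly and lies in this closure meets [u R] outside [N], so by
    uniformity [colon u W] is essential modulo [P], hence dense, and [u] lies
    in [W]. *)
Lemma exists_cover I :
  two_sided_ideal I -> nonzero_set I -> I `<=` N -> (exists x, ~ N x) ->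
  exists M, [/\ right_tau_closed iota M, N `<=` M, ~ (M `<=` N)
    & forall W, right_tau_closed iota W -> N `<=` W -> W `<=` M ->
        W `<=` N \/ M `<=` W].
Proof.
have [rN cN] := closedN.
move=> [rI [_ _ lI]] [i Ii i0] IN /associated_prime[m nNm primeA].
have [_ [[z ->] nNu uni]] := exists_uniform nNm.
set u := m * z in nNu uni *.
have rU := right_ideal_principal u; have uu := principal_id u.
have uM x y : principal u x -> principal u (x * y).
  by move=> ux; apply: right_idealM.
have rUN := right_ideal_add rU rN.
have NM : N `<=` closure iota (add_set (principal u) N).
  by move=> x Nx; apply: subset_closure => //; apply: (subset_addr rU).
exists (closure iota (add_set (principal u) N)).
split=> //; first exact: closed_closure.
  move=> MN; apply/nNu/MN/subset_closure => //.
  exact: (subset_addl rN).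
move=> W cW NW WM.
have [WN|/existsNP[w /not_implyP[Ww nNw]]] := pselect (W `<=` N); first by left.
right; have [rW cW'] := cW; apply: closure_min => //.
suff Wu : W u.
  move=> _ [_ [n [[y ->] Nn ->]]].
  by apply: right_idealD => //; [apply: right_idealM|apply: NW].
have [F dF Fw] := WM w Ww.
have [f /not_implyP[Ff nNwf]] : exists f, ~ (F f -> N (w * f)).
  by apply/existsNP => FN; apply: nNw; apply: (cN _ F dF).
have [_ [n [[y ->] Nn wfE]]] := Fw f Ff.
have Wv : W (u * y).
  have -> : u * y = w * f - n by rewrite wfE addrK.
  by apply: right_idealB => //; [apply: right_idealM|apply: NW].
have nNv : ~ N (u * y).
  by move=> Nv; apply: nNwf; rewrite wfE; apply: right_idealD.
have PuW : cyclic_annihilator m `<=` colon u W by move=> x mx; apply/NW/mx.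
apply: (cW' u (colon u W)) => //.
apply: (essential_dense accR primeA) => //.
- exact: closed_cyclic_annihilator.
- by exists i => // s; apply/IN/lI.
- exact: right_ideal_colon.
move=> x nPx; have [Nux|nNux] := pselect (N (u * x)).
  by exists 1; rewrite mulr1 //; apply: NW.
have [s [_ [n' [[t ->] Nn' e]]] nNs] :=
  uni _ _ (uM _ y uu) nNv (uM _ x uu) nNux.
exists s; last by move/(_ z); rewrite mulrA.
rewrite /colon /= mulrA e; apply: right_idealD => //; last exact: NW.
exact: right_idealM.
Qed.

End Covers.

(** * Bounded height functions *)

Section Heights.
Variables (R Q : unitRingType) (iota : {rmorphism R -> Q}).

Definition height_function (N : set R) (n : nat) (h : set R -> nat) : Prop :=
  (forall J, (h J <= n)%N) /\
  forall J J', right_tau_closed iota J -> right_tau_closed iota J' ->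
    N `<=` J -> J `<=` J' -> ~ (J' `<=` J) -> (h J < h J')%N.

(** The value at [J] is the height of the join of [J] and [M], plus one if
    [M] is below [J]. If [J] lies strictly below [J'] and both have the same
    join with [M], then by modularity their meets with [M] differ, and as [M]
    covers [N], these meets are [N] and [M]. *)
Lemma height_function_cover N M n h :
  right_tau_closed iota M -> N `<=` M ->
  (forall W, right_tau_closed iota W -> N `<=` W -> W `<=` M ->
     W `<=` N \/ M `<=` W) ->
  height_function M n h -> exists h', height_function N n.+1 h'.
Proof.
move=> cM NM cov [hn hlt]; have [rM _] := cM.
pose h' J := (h (closure iota (add_set J M)) + `[< M `<=` J >])%N.
exists h'; split=> [J|J J' cJ cJ' NJ JJ' nJ'J].
  by rewrite -addn1; apply: leq_add; [exact: hn|case: asbool].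
have [[rJ cJr] [rJ' _]] := (cJ, cJ').
have rJM := right_ideal_add rJ rM; have rJ'M := right_ideal_add rJ' rM.
have sub : closure iota (add_set J M) `<=` closure iota (add_set J' M).
  by apply: closure_mono => _ [x [y [/JJ' Jx My ->]]]; exists x, y.
have Mle : (`[< M `<=` J >] <= `[< M `<=` J' >])%N.
  by case: asboolP => // MJ; rewrite (introT (asboolP _)) // => x /MJ/JJ'.
have [sub'|nsub] :=
    pselect (closure iota (add_set J' M) `<=` closure iota (add_set J M)).
  rewrite /h' (_ : closure iota (add_set J M) = closure iota (add_set J' M));
    last exact/seteqP.
  rewrite ltn_add2l.
  have J'cl : J' `<=` closure iota (add_set J M).
    by move=> x J'x; apply/sub'/subset_closure => //; apply: (subset_addl rM).
  have nMJ : ~ M `<=` J.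
    move=> MJ; apply: nJ'J => x /J'cl; apply: closure_min => //.
    by move=> _ [y [z [Jy /MJ Jz ->]]]; apply: right_idealD.
  rewrite (introF (asboolP _) nMJ).
  suff MJ' : M `<=` J' by rewrite (introT (asboolP _)).
  have cW := closed_setI cJ' cM.
  have [||WN|] := cov _ cW.
  + by move=> x Nx; split; [apply/JJ'/NJ|apply: NM].
  + by move=> x [].
  + case: nJ'J => x J'x; have [F dF Fx] := J'cl x J'x.
    apply: (cJr x F dF) => f /Fx[y [z [Jy Mz e]]].
    rewrite e; apply: right_idealD => //; apply/NJ/WN; split=> //.
    have -> : z = x * f - y by rewrite e addrC addKr.
    by apply: right_idealB => //; [apply: right_idealM|apply: JJ'].
  + by move=> MJ' x /MJ'[].
rewrite -addSn; apply: leq_add => //; apply: hlt => //.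
- exact: closed_closure.
- exact: closed_closure.
- by move=> x Mx; apply: subset_closure => //; apply: (subset_addr rJ).
Qed.

Hypothesis accR : acc (right_tau_closed iota).
Hypotheses (simpleQ : simple_ring Q) (quotQ : classical_quotient_ring iota).
Hypothesis maxR : maximal_order iota.

(** Noetherian induction: a cover of a maximal counterexample has a height
    function, which then extends to the counterexample. *)
Lemma exists_height_function I N :
  two_sided_ideal I -> nonzero_set I -> right_tau_closed iota N -> I `<=` N ->
  exists n h, height_function N n h.
Proof.
move=> tI nzI cN0 IN0; apply: contrapT => noN.
pose S N := I `<=` N /\ ~ exists n h, height_function N n h.
have [|{noN cN0 IN0}M [cM [IM noM] maxM]] := acc_maximal (S := S) accR.
  by exists N.
apply: noM; have [MT|/existsNP nMT] := pselect (forall x, M x).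
  exists 0, (fun=> 0); split=> // J J' _ _ MJ _ []x _.
  exact: MJ.
have [K [cK MK nKM cov]] :=
  exists_cover accR cM simpleQ quotQ maxR tI nzI IM nMT.
have [n [h hK]] : exists n h, height_function K n h.
  apply: contrapT => noK; apply: nKM; apply: maxM => //.
  by split=> // x /IM/MK.
by exists n.+1; apply: height_function_cover hK.
Qed.

End Heights.

(** * Factorizations *)

Section Factorizations.
Variables (R Q : unitRingType) (iota : {rmorphism R -> Q}).
Hypothesis quotQ : classical_quotient_ring iota.

Lemma cancellative_essential (a : R) :
  cancellative a -> essential_right_ideal (principal a).
Proof.
have [inj inv rfrac _] := quotQ.
move=> ca; split=> [|J rJ [x Jx x0]]; first exact: right_ideal_principal.
have [y [t [ct e]]] := rfrac ((iota a)^-1 * iota x).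
have xt : x * t = a * y.
  apply: inj; rewrite !rmorphM -[iota x](mulVKr (inv _ ca)) e.
  by rewrite -!mulrA mulVr ?inv ?mulr1.
exists (x * t); first by split; [exists y|apply: right_idealM].
by move=> xt0; apply: x0; case: ct => _; apply; rewrite xt0 mul0r.
Qed.

Lemma principal_nonunit (a b : R) :
  cancellative a -> cancellative b -> b \isn't a GRing.unit ->
  ~ principal a `<=` principal (a * b).
Proof.
move=> [la _] [lb _] nub /(_ a (principal_id a))[c].
rewrite -mulrA -{1}[a]mulr1 => /la bc.
have cb : c * b = 1 by apply: lb; rewrite mulrA -bc mul1r mulr1.
by move/negP: nub; apply; apply/unitrP; exists c.
Qed.

Definition nonunit_factors (s : seq R) : Prop :=
  forall u, u \in s -> cancellative u /\ u \isn't a GRing.unit.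

(** Each nonunit factor makes the principal right ideal of the partial product
    strictly smaller. The left factor [c] carries the partial product through
    the induction. *)
Lemma size_le_height N n h c s :
  height_function iota N n h -> cancellative c -> nonunit_factors s ->
  N `<=` principal (c * \prod_(u <- s) u) ->
  (h (principal (c * \prod_(u <- s) u)) + size s <= h (principal c))%N.
Proof.
move=> [_ hlt]; have [inj inv _ _] := quotQ.
elim: s c => [|u s IHs] c cc nus; first by rewrite big_nil mulr1 addn0.
have nus' : nonunit_factors s by move=> v vs; apply: nus; rewrite inE vs orbT.
have [cu nuu] := nus u (mem_head _ _).
have ccu := cancellativeM cc cu.
rewrite big_cons mulrA /= addnS => Ncus.
apply: leq_ltn_trans (IHs _ ccu nus' Ncus) _.
apply: hlt.
- by apply: closed_principal => //; apply: inv.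
- by apply: closed_principal => //; apply: inv.
- by move=> x /Ncus[y ->]; rewrite -mulrA; exists (\prod_(u <- s) u * y).
- by move=> _ [y ->]; rewrite -mulrA; exists (u * y).
- exact: principal_nonunit.
Qed.

Definition bounded_factorizations (a : R) : Prop :=
  exists n, forall s, nonunit_factors s -> a = \prod_(u <- s) u ->
    (size s <= n)%N.

(** In a factorization into the largest number of nonunits each factor is an
    atom, since splitting a factor into two nonunits would lengthen it. *)
Lemma BF_ring_bounded :
  (forall a : R, cancellative a -> bounded_factorizations a) -> BF_ring R.
Proof.
move=> bnd; split=> [a ca nua|a ca]; last first.
  have [n sn] := bnd a ca; exists n => s ats; apply: sn => u /ats[].
  by [].
have [n sn] := bnd a ca.
pose len k := `[< exists s,
  [/\ nonunit_factors s, a = \prod_(u <- s) u & size s = k] >].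
have len1 : exists k, len k.
  exists 1%N; apply/asboolP; exists [:: a]; rewrite big_seq1; split=> // u.
  by rewrite inE => /eqP->.
have lenn k : len k -> (k <= n)%N by move=> /asboolP[s [nus aE <-]]; apply: sn.
have [k /asboolP[s [nus aE sk]] maxk] := ex_maxnP len1 lenn.
exists s; split=> // u us; have [cu nuu] := nus u us; split=> // b c cb cc uE.
apply: contrapT => /not_orP[/negP nub /negP nuc].
case/splitPr: us => s1 s2 in nus aE sk *.
suff /maxk : len k.+1 by rewrite ltnn.
apply/asboolP; exists (s1 ++ [:: b, c & s2]); split.
- move=> v; rewrite mem_cat !inE orbCA => /or3P[/eqP->//|vs|/orP[/eqP->//|vs]].
    by apply: nus; rewrite mem_cat vs.
  by apply: nus; rewrite mem_cat inE vs !orbT.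
- by rewrite aE !big_cat /= !big_cons uE !mulrA.
- by rewrite -sk !size_cat /= !addnS.
Qed.

End Factorizations.

Theorem proposition3p8 (R Q : unitRingType) (iota : {rmorphism R -> Q}) :
  prime_ring R -> goldie_ring R ->
  simple_ring Q -> artinian_ring Q -> classical_quotient_ring iota ->
  krull_order iota -> bounded_ring R ->
  BF_ring R.
Proof.
move=> _ _ simpleQ _ quotQ [maxR accR _] bndR; have [inj inv _ _] := quotQ.
apply: BF_ring_bounded => a ca.
have [I [tI nzI Ia]] := bndR _ (or_introl (cancellative_essential quotQ ca)).
have ca' := closed_principal inj (inv a ca).
have [n [h hP]] := exists_height_function accR simpleQ quotQ maxR tI nzI ca' Ia.
exists n => s nus aE; have [hn _] := hP.
apply: leq_trans (hn (principal 1)); apply: leq_trans (leq_addl _ _) _.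
apply: (size_le_height quotQ hP) => //; first exact: cancellative1.
by rewrite mul1r -aE.
Qed.
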